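(* Let $\mathbf M$ be a non-degenerate cm-monoid. Then: (1) $1[k]\neq 1[j]$ for all $k\neq j$ in $\omega$; (2) $\mathbf M$ is faithful; (3) $\mathbf M$ is noncommutative, i.e. the monoid $(M,\cdot,1)$ is not commutative.
   Context: $S_\omega$ is the group of permutations $\sigma$ of $\omega$ with $\{n:\sigma(n)\neq n\}$ finite; such $\sigma$ is a permutation of $k=\{0,\dots,k-1\}$ if $\{n:\sigma(n)\ne n\}\subseteq k$. $\iota$ is the identity and $\tau^n_0$ is the transposition exchanging $0$ and $n$. A \emph{merge algebra} is $\mathbf A=(A,\star_n,\bar\sigma)_{n\in\omega,\sigma\in S_\omega}$ with $\star_n$ binary and $\bar\sigma$ unary such that: (B1) each $(A,\star_n)$ is an idempotent semigroup; (B2) $x\star_0y=y$; (B3) for $k\ge n$: $(x\star_k y)\star_n z=x\star_n z$ and $x\star_k(y\star_n z)=x\star_k z$; (B4) for $k<n$: $(x\star_k y)\star_n z=x\star_k(y\star_n z)$; (B5) $\bar\sigma(\bar\tau(x))=\overline{\tau\circ\sigma}(x)$ and $\bar\iota(x)=x$; (B6) if $n\le k$, $\sigma$ is a permutation of $k$, and $f_i=x$ if $\sigma(i)<n$, $f_i=y$ otherwise ($0\le i<k$), then $\bar\sigma(x\star_n y)=((\dots(\bar\sigma(f_0)\star_1\bar\sigma(f_1))\star_2\dots)\star_{k-1}\bar\sigma(f_{k-1}))\star_k y$ (right-hand side read as $y$ if $k=0$); (B7) if $\sigma(i)=\tau(i)$ for all $m\le i<n$, then $(z\star_m\bar\sigma(x))\star_n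 y=(z\star_m\bar\tau(x))\star_n y$. A \emph{cm-monoid} is $\mathbf M=(M,\cdot,1,\star_n,\bar\sigma)_{n\in\omega,\sigma\in S_\omega}$ such that $(M,\cdot,1)$ is a monoid, $(M,\star_n,\bar\sigma)$ is a merge algebra, $(x\star_n y)\cdot z=(x\cdot z)\star_n(y\cdot z)$ for all $n$, and $\bar\sigma(x\cdot y)=\bar\sigma(x)\cdot y$ for all $\sigma\in S_\omega$. $x[n]=\bar\tau^n_0(x)\star_1 1$ is the $n$-coordinate of $x$. $\mathbf M$ is \emph{degenerate} if $\bar\sigma(x)=x$ for all $\sigma\in S_\omega$ and $x\star_n y=y$ for all $n\in\omega$ (for all $x,y\in M$); it is \emph{faithful} if $\bar\sigma\neq\bar\tau$ (as maps $M\to M$) whenever $\sigma\ne\tau$ in $S_\omega$. *)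

(* Defs.v *)
From HB Require Import structures.
From mathcomp Require Import all_boot all_classical.

Set Implicit Arguments.
Unset Strict Implicit.
Unset Printing Implicit Defensive.

Local Open Scope classical_set_scope.

Definition fsupp (f : nat -> nat) : set nat := [set n | f n <> n].

(* The group S_omega; Leibniz equality on it is equality of functions (fpermP). *)
Record fperm := FPerm {
  fperm_fun :> nat -> nat;
  fperm_bij : bijective fperm_fun;
  fperm_fin : finite_set (fsupp fperm_fun)
}.

Lemma fpermP (s t : fperm) : s =1 t <-> s = t.
Proof.
split=> [|-> //]; case: s t => [f fb ff] [g gb gf] /= /funext fg.
by subst g; congr FPerm; exact: Prop_irrelevance.
Qed.

Lemma fperm_id_fin : finite_set (fsupp id).
Proof. by rewrite (_ : fsupp id = set0) // -subset0 => n; apply. Qed.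

Definition fperm_id : fperm :=
  FPerm (Bijective (fun=> erefl) (fun=> erefl)) fperm_id_fin.

Lemma fperm_comp_fin (t s : fperm) : finite_set (fsupp (t \o s)).
Proof.
apply: (@sub_finite_set _ _ (fsupp t `|` fsupp s)).
  move=> n tsn; have [sn|sn] := pselect (s n = n); last by right.
  by left => tn; apply: tsn; rewrite /= sn.
by rewrite finite_setU; split; exact: fperm_fin.
Qed.

Definition fperm_comp (t s : fperm) : fperm :=
  FPerm (bij_comp (fperm_bij t) (fperm_bij s)) (fperm_comp_fin t s).

Definition swap0 (n i : nat) : nat :=
  if i == 0 then n else if i == n then 0 else i.

Lemma swap0K n : involutive (swap0 n).
Proof.
move=> i; rewrite /swap0; case: (eqVneq i 0) => [->|i0].
  by rewrite eqxx; case: eqP.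
by case: (eqVneq i n) => [->|/negPf ->]; rewrite ?eqxx // (negPf i0).
Qed.

Lemma swap0_fin n : finite_set (fsupp (swap0 n)).
Proof.
apply: (@sub_finite_set _ _ `I_n.+1) => // i; rewrite /fsupp /swap0 /=.
by case: (eqVneq i 0) => [->|_] //; case: (eqVneq i n) => [->|_].
Qed.

(* The transposition tau^n_0, which is the identity for n = 0. *)
Definition fperm_swap0 (n : nat) : fperm :=
  FPerm (inv_bij (@swap0K n)) (swap0_fin n).

(* ((g 0 *_1 g 1) *_2 ...) *_k g k *)
Fixpoint merge_upto A (star : nat -> A -> A -> A) (g : nat -> A) (k : nat) : A :=
  if k is k'.+1 then star k (merge_upto star g k') (g k) else g 0.

(* (((g 0 *_1 g 1) *_2 ...) *_(k-1) g (k-1)) *_k y, read as y when k = 0 *)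
Definition merge_seq A (star : nat -> A -> A -> A) (g : nat -> A) (k : nat)
    (y : A) : A :=
  if k is k'.+1 then star k (merge_upto star g k') y else y.

HB.mixin Record isMergeAlgebra A := {
  star : nat -> A -> A -> A;
  act : fperm -> A -> A;
  starA : forall n, associative (star n);
  starxx : forall n, idempotent_op (star n);
  star0 : forall x y, star 0 x y = y;
  star_absl : forall n k x y z, n <= k ->
    star n (star k x y) z = star n x z;
  star_absr : forall n k x y z, n <= k ->
    star k x (star n y z) = star k x z;
  star_ltA : forall n k x y z, k < n ->
    star n (star k x y) z = star k x (star n y z);
  act_comp : forall (s t : fperm) x, act s (act t x) = act (fperm_comp t s) x;
  act_id : forall x, act fperm_id x = x;
  act_star : forall n k (s : fperm) x y, n <= k -> fsupp s `<=` `I_k ->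
    act s (star n x y) =
      merge_seq star (fun i => act s (if s i < n then x else y)) k y;
  star_act : forall m n (s t : fperm) x y z,
    (forall i, m <= i -> i < n -> s i = t i) ->
    star n (star m z (act s x)) y = star n (star m z (act t x)) y
}.

#[short(type="mergeAlgType")]
HB.structure Definition MergeAlgebra := {A of isMergeAlgebra A}.

HB.mixin Record MergeAlgebra_isCMMonoid M
    of monoid.Monoid M & MergeAlgebra M := {
  starMl : forall n (x y z : M), (star n x y * z = star n (x * z) (y * z))%g;
  actMl : forall (s : fperm) (x y : M), (act s (x * y) = act s x * y)%g
}.

#[short(type="cmMonoidType")]
HB.structure Definition CMMonoid :=
  {M of MergeAlgebra_isCMMonoid M & monoid.Monoid M & MergeAlgebra M}.

Definition coordinate (M : cmMonoidType) (x : M) (n : nat) : M :=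
  star 1 (act (fperm_swap0 n) x) 1%g.

Definition degenerate (M : cmMonoidType) : Prop :=
  (forall (s : fperm) (x : M), act s x = x) /\
  (forall (n : nat) (x y : M), star n x y = y).

Definition faithful (M : cmMonoidType) : Prop :=
  forall s t : fperm, s <> t -> act s <> act t :> (M -> M).

(* Main.v *)
(* Think of x as a sequence (x_0, x_1, ...), with x *_n y taking its first n
   terms from x and the others from y, and with (act s x)_i = x_(s i).  If
   1[k] = 1[j] with k < j, right multiplication by x = z *_(k+1) y identifies
   the k-th term of z with the j-th term of y; as z and y are arbitrary,
   x *_1 y = y.  Permuting coordinates propagates this to every *_n, and M is
   degenerate.  Faithfulness follows because the terms of act s 1 are the
   1[s i], and noncommutativity because 1[1] * 1[2] and 1[2] * 1[1] begin with
   1[1] and 1[2] respectively. *)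
Require Import Defs.
From mathcomp Require Import all_boot all_classical.

Set Implicit Arguments.
Unset Strict Implicit.

Local Open Scope classical_set_scope.

Lemma finite_set_bounded {A : set nat} :
  finite_set A -> exists k, A `<=` `I_k.
Proof.
case/finite_seqP=> r ->; exists (\max_(i <- r) i).+1 => i /= ir.
by rewrite ltnS; exact: leq_bigmax_seq.
Qed.

Section MergeAlgebraTheory.
Variable A : mergeAlgType.
Implicit Types (s t : fperm) (x y z w : A).

Lemma act_surj s x : exists y, act s y = x.
Proof.
have [g sK gK] := fperm_bij s.
have gfin : finite_set (fsupp g).
  apply: sub_finite_set (fperm_fin s) => n gn sn.
  by apply: gn; rewrite -[in LHS]sn sK.
exists (act (FPerm (Bijective gK sK) gfin) x).
rewrite act_comp -[RHS]act_id; congr (act _ x).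
by apply/fpermP => n /=; rewrite sK.
Qed.

Lemma star1_merge_upto (g : nat -> A) k w :
  star 1 (merge_upto star g k) w = star 1 (g 0) w.
Proof. by elim: k => //= k IHk; rewrite star_absl. Qed.

Lemma star1_act_star s n x y w :
  star 1 (act s (star n x y)) w = star 1 (act s (if s 0 < n then x else y)) w.
Proof.
have [k sk] := finite_set_bounded (fperm_fin s).
(* The bound covers both [n] and the support; as a successor it avoids the [k = 0] case of
   [merge_seq]. *)
have nk : n <= (n + k).+1 by rewrite -addnS leq_addr.
have snk : fsupp s `<=` `I_(n + k).+1.
  by move=> i /sk /= /leq_trans; apply; rewrite -addSn leq_addl.
rewrite (act_star _ _ _ _ _ nk snk) /= star_absl //; exact: star1_merge_upto.
Qed.

Lemma star1_act_eq s t x w :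
  s 0 = t 0 -> star 1 (act s x) w = star 1 (act t x) w.
Proof.
move=> st; have := @star_act A 0 1 s t x w x; rewrite !star0; apply.
by case.
Qed.

Hypothesis star1_trivial : forall x y, star 1 x y = y.

(* Moving the only term of x in x *_1 y = y to position n turns it into the
   n-th term of a merge whose earlier terms are discarded by *_n. *)
Lemma star_trivial n x y : star n x y = y.
Proof.
elim: n x y => [|n IHn] x y; first exact: star0.
case: n IHn => [_|n IHn]; first exact: star1_trivial.
suff indep z : star n.+2 (act (fperm_swap0 n.+1) z) y =
    act (fperm_swap0 n.+1) y.
  have [x' <-] := act_surj (fperm_swap0 n.+1) x.
  have [y' y'E] := act_surj (fperm_swap0 n.+1) y.
  by rewrite indep -(indep y') y'E starxx.
rewrite -[in RHS](star1_trivial z y) (@act_star _ 1 n.+2) //=.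
  by rewrite IHn /swap0 /= eqxx.
by move=> i; rewrite /fsupp /= /swap0; case: eqP => [->|_] //; case: eqP => [->|].
Qed.

(** Since x is x *_0 x, [act_star] turns [act s x] into a merge whose last argument is x itself,
    with no permutation applied. *)
Lemma act_trivial s x : act s x = x.
Proof.
have [k sk] := finite_set_bounded (fperm_fin s).
rewrite -[in LHS](star0 x x) (@act_star _ 0 k) //.
by case: k {sk} => //= k; exact: star_trivial.
Qed.

End MergeAlgebraTheory.

Section CMMonoidTheory.
Variable M : cmMonoidType.
Implicit Types x y z w : M.

Lemma coordinate1_mul k x w :
  star 1 (coordinate 1%g k * x)%g w = star 1 (act (fperm_swap0 k) x) w.
Proof. by rewrite /coordinate starMl -actMl !mul1g star_absl. Qed.

Lemma coordinate1_eq_degenerate k j :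
  k < j -> coordinate (1%g : M) k = coordinate 1%g j -> degenerate M.
Proof.
move=> kj ekj.
have key z y w :
    star 1 (act (fperm_swap0 k) z) w = star 1 (act (fperm_swap0 j) y) w.
  have := coordinate1_mul k (star k.+1 z y) w.
  rewrite ekj coordinate1_mul !star1_act_star /= /swap0 /=.
  by rewrite ltnSn ltnS leqNgt kj.
have star1E x y : star 1 x y = y.
  have [x' <-] := act_surj (fperm_swap0 k) x.
  have [y' y'E] := act_surj (fperm_swap0 k) y.
  (* By [key], x *_1 y does not depend on x, so x may be replaced by y and idempotence applies. *)
  by rewrite (key _ y') -(key y') y'E starxx.
by split=> [s x|n x y]; [exact: act_trivial|exact: star_trivial].
Qed.

Hypothesis ndegM : ~ degenerate M.

Lemma coordinate1_inj : injective (coordinate (1%g : M)).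
Proof.
move=> k j ekj; case: (ltngtP k j) => // [kj|jk]; case: ndegM.
  exact: coordinate1_eq_degenerate kj ekj.
exact: coordinate1_eq_degenerate jk (esym ekj).
Qed.

Lemma nondegenerate_faithful : faithful M.
Proof.
move=> s t st est; apply: st; apply/fpermP => i; apply: coordinate1_inj.
(* The composite permutation sends 0 to [u i], and under *_1 only that value matters. *)
have term (u : fperm) : coordinate (1%g : M) (u i) =
    star 1 (act (fperm_swap0 i) (act u 1%g)) 1%g.
  by rewrite act_comp; exact: star1_act_eq.
by rewrite !term est.
Qed.

Lemma nondegenerate_noncommutative : ~ commutative (fun x y : M => (x * y)%g).
Proof.
(* Index 0 is excluded: 1[j] is sure to share the terms of 1 only past position 0. *)
move=> mulC; have term k j : 0 < k ->
    star 1 (coordinate (1%g : M) k * coordinate 1%g j)%g 1%g =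
    coordinate 1%g k.
  by move=> k0; rewrite coordinate1_mul star1_act_star /= /swap0 /= ltnNge k0.
suff /coordinate1_inj : coordinate (1%g : M) 1 = coordinate 1%g 2 by [].
by rewrite -(term 1 2) // mulC term.
Qed.

End CMMonoidTheory.

Theorem lemma4p12 (M : cmMonoidType) (hM : ~ degenerate M) :
  [/\ forall k j : nat, k <> j ->
        coordinate (1%g : M) k <> coordinate (1%g : M) j,
      faithful M
    & ~ commutative (fun x y : M => (x * y)%g)].
Proof.
split.
- by move=> k j kj /(coordinate1_inj hM).
- exact: nondegenerate_faithful.
- exact: nondegenerate_noncommutative.
Qed.
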